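(* Let $k$, $k'$, $\ell$ and $t$ be positive integers with $k \geq k' \geq t+1$, $\ell\geq 2$, and let $n\geq (2k-t+1)(t+1)+(k-t+1)k'+k+2\ell-1$ be an integer. Let $V$ be an $n$-dimensional vector space over the finite field $\mathbb{F}_{q}$. Suppose that two families $\mathcal{F}\subseteq \genfrac{[}{]}{0pt}{}{V}{k}$ and $\mathcal{G}\subseteq \genfrac{[}{]}{0pt}{}{V}{k'}$ are $\ell$-weakly cross $t$-intersecting. Then \[ |\mathcal{F}|\cdot |\mathcal{G}|\leq \genfrac{[}{]}{0pt}{}{n-t}{k-t}_q\genfrac{[}{]}{0pt}{}{n-t}{k'-t}_q. \] Moreover, equality holds only if $\mathcal{F}=\{F\in \genfrac{[}{]}{0pt}{}{V}{k}\colon T\subseteq F\}$ and $\mathcal{G}=\{G\in \genfrac{[}{]}{0pt}{}{V}{k'}\colon T\subseteq G\}$ for some $t$-dimensional subspace $T$ of $V$.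
   Context: $\mathbb{F}_q$ is the finite field of order $q$. For an $n$-dimensional vector space $V$ over $\mathbb{F}_q$, $\genfrac{[}{]}{0pt}{}{V}{k}$ denotes the set of all $k$-dimensional subspaces of $V$. The Gaussian binomial coefficient is $\genfrac{[}{]}{0pt}{}{a}{b}_{q}= \prod_{i=0}^{b-1} \frac{q^{a-i}-1}{q^{b-i}-1}$ for positive integers $a,b$, with $\genfrac{[}{]}{0pt}{}{a}{0}_{q}=1$ and $\genfrac{[}{]}{0pt}{}{a}{b}_{q}=0$ for $b<0$. Families $\mathcal{F}\subseteq \genfrac{[}{]}{0pt}{}{V}{k}$ and $\mathcal{G}\subseteq \genfrac{[}{]}{0pt}{}{V}{k'}$ are called $\ell$-weakly cross $t$-intersecting if $\sum_{1\leq i,j\leq \ell}\dim(F_{i}\cap G_{j})\geq \ell^{2}t-\ell+1$ (the sum being over all $\ell^2$ pairs $(i,j)$) for every choice of $\ell$ distinct members $F_{1},\ldots,F_{\ell}\in\mathcal{F}$ and $\ell$ distinct members $G_{1},\ldots,G_{\ell}\in\mathcal{G}$.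
   Formalization: Both families are assumed to have at least ℓ members; otherwise the weakly cross t-intersecting condition is vacuous and the bound fails (e.g. q=2, t=2, k=k'=3, ℓ=2, n=27, one 3-space against all 3-spaces). *)

(* Defs.v *)
From HB Require Import structures.
From mathcomp Require Import all_boot all_order all_algebra all_field.

Set Implicit Arguments.
Unset Strict Implicit.
Unset Printing Implicit Defensive.

Import GRing.Theory Num.Theory.

(* A vector space over a finite field has finitely many subspaces, so families
   of subspaces can be taken in {set {vspace V}}. *)
Section FiniteVspace.
Import VectorInternalTheory.
Variables (K : finFieldType) (V : vectType K).
HB.instance Definition _ := [Countable of {vspace V} by <:].
HB.instance Definition _ := [Finite of {vspace V} by <:].
End FiniteVspace.

Definition grassmannian (K : finFieldType) (V : vectType K) (k : nat) :
    {set {vspace V}} :=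
  [set U | \dim U == k].

(* The quotient is taken in rat.  The truncated a - i is harmless: for b > a the
   product contains the factor i = a, whose numerator is 0. *)
Definition gauss_binom (q a b : nat) : rat :=
  (\prod_(i < b)
     ((q%:R ^+ (a - i) - 1) / (q%:R ^+ (b - i) - 1)))%R.

(* l distinct members of a family are given by an injective map from 'I_l.
   The term - l is moved to the other side of the inequality because
   subtraction on nat is truncated. *)
Definition weakly_cross_intersecting (K : finFieldType) (V : vectType K)
    (l t : nat) (FF GG : {set {vspace V}}) : Prop :=
  forall F G : 'I_l -> {vspace V},
    injective F -> injective G ->
    (forall i, F i \in FF) -> (forall j, G j \in GG) ->
    l ^ 2 * t + 1 <= \sum_(i < l) \sum_(j < l) \dim (F i :&: G j) + l.

(* Main.v *)
Require Import Defs.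
From HB Require Import structures.
From mathcomp Require Import all_boot all_order all_algebra all_field zify.
Set Implicit Arguments.
Unset Strict Implicit.
Unset Printing Implicit Defensive.
Import Order.TTheory GRing.Theory Num.Theory.

(** Write q for the order of K, [A] and [B] for the number of k- and
    k'-subspaces of V through a fixed t-subspace, and [A1], [B1] for the same
    numbers for a fixed (t+1)-subspace.  The two bounds are [A * B], and the
    dimension of V is so large that the ratios [A / A1 >= q ^ (n - k)] and
    [B / B1 >= q ^ (n - k')] absorb every other factor that occurs.

    Fix l distinct members [H_1, ..., H_l] of GG and call F in FF heavy when
    its dimensions of intersection with the [H_j] add up to at least [l * t].
    If l members of FF were not heavy, all the pairs together would give at
    most [l * (l * t - 1)], against the hypothesis; so fewer than l members of
    FF are not heavy ([few_light]).  This averaging is the only use of the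
    hypothesis, and it is applied to two choices of the [H_j].

    For arbitrary [H_j], a heavy F meets some [H_j] in dimension at least t, so
    it lies in the star of one of the few t-subspaces of the [H_j].  Hence FF is
    not much larger than its largest part inside a star ([card_family_le]).

    Suppose now that some member G0 of GG does not contain the t-subspace T,
    and let G0 be one of the [H_j].  If F contains T and meets every [H_j]
    inside T, then the sum is at most [l * t - 1], because the intersection with
    G0 is a proper subspace of T.  So a heavy F through T contains a
    (t+1)-subspace spanned by T and a vector of some [H_j], and there are at
    most [l * q ^ k' * A1] of these ([card_star_le]).

    Suppose that the product of the sizes is at least [A * B].  By
    [card_family_le] for GG, FF has at least [A] members up to a small factor;
    by [card_family_le] for FF, the part of FF inside the star of some T is then
    too large for [card_star_le], so every member of GG contains T.  Now GG
    itself is the large part of a star, and [card_star_le] with the families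
    exchanged shows that every member of FF contains T.  Both families thus
    lie in stars of sizes [A] and [B], and equality forces them to be the whole
    stars. *)

(** * Counting the subspaces in an interval *)

Section Counting.
Variables (K : finFieldType) (V : vectType K).
Implicit Types U W Z T : {vspace V}.
Local Notation q := #|K|.

Lemma card_field_gt1 : 2 <= q. Proof. exact: finNzRing_gt1. Qed.

Lemma card_vectors U :
  #|[set x : finvect_type V | (x : V) \in U]| = q ^ \dim U.
Proof.
(* [finvect_type V] has the same structure as V only once V is a constructor. *)
rewrite cardsE; move: U; case: V => T c U.
exact: (@card_vspace K (finvect_type (Vector.Pack c)) _ U).
Qed.

Definition interval W Z k : {set {vspace V}} :=
  [set U in grassmannian V k | (W <= U <= Z)%VS].

Lemma card_vectorsD W U : (W <= U)%VS ->
  #|[set x : finvect_type V | ((x : V) \in U) && ((x : V) \notin W)]| =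
  q ^ \dim U - q ^ \dim W.
Proof.
move=> WU; rewrite -!card_vectors -cardsDS; last first.
  by apply/subsetP=> x; rewrite !inE => /(subvP WU).
by apply: eq_card => x; rewrite !inE andbC.
Qed.

Lemma dim_addv_line W (x : V) : x \notin W -> \dim (W + <[x]>) = (\dim W).+1.
Proof.
move=> xW; rewrite dimv_disjoint_sum ?dim_vline.
  by case: eqP xW => [->|]; rewrite ?mem0v ?addn1.
apply/eqP; rewrite -subv0; apply/subvP=> y.
rewrite memv_cap => /andP[yW /vlineP[a ay]].
case: (eqVneq a 0%R) => [a0|a0]; first by rewrite ay a0 scale0r mem0v.
by move: xW; rewrite -[x](scalerK a0) -ay rpredZ.
Qed.

(** Double count the pairs of a subspace U in the interval and a vector x of U
    outside W; for fixed x the subspaces are those above [W + <[x]>].  The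
    recursion on the codimension of W gives exact values, upper bounds and
    ratios, without quotient spaces. *)
Lemma interval_rec W Z k :
  #|interval W Z k| * (q ^ k - q ^ \dim W) =
  \sum_(x : finvect_type V | ((x : V) \in Z) && ((x : V) \notin W))
     #|interval (W + <[x : V]>) Z k|.
Proof.
rewrite -sum_nat_const.
transitivity (\sum_(U in interval W Z k)
   \sum_(x : finvect_type V | ((x : V) \in U) && ((x : V) \notin W)) 1).
  apply: eq_bigr => U; rewrite !inE => /andP[/eqP dU /andP[WU _]].
  by rewrite -dU -card_vectorsD // -sum1dep_card.
rewrite (exchange_big_dep
  (fun x : finvect_type V => ((x : V) \in Z) && ((x : V) \notin W))) /=.
  apply: eq_bigr => x /andP[xZ xW]; rewrite -sum1_card.
  apply: eq_bigl => U; rewrite !inE subv_add -memvE.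
  rewrite xW andbT; case: (\dim U == k) => //=.
  by case: (W <= U)%VS; case: (U <= Z)%VS; rewrite /= ?andbF ?andbT.
move=> U x; rewrite !inE => /andP[_ /andP[_ UZ]] /andP[xU ->]; rewrite andbT.
exact: (subvP UZ).
Qed.

Lemma interval_id W Z : (W <= Z)%VS -> interval W Z (\dim W) = [set W].
Proof.
move=> WZ; apply/setP=> U; rewrite !inE.
apply/andP/eqP => [[/eqP dU /andP[WU _]]|->].
  by apply/eqP; rewrite eq_sym eqEdim WU dU leqnn.
by rewrite eqxx subvv.
Qed.

Lemma natr_expB (a b : nat) : b <= a ->
  ((q ^ a - q ^ b)%N%:R = (q%:R ^+ b * (q%:R ^+ (a - b) - 1)) :> rat)%R.
Proof.
move=> ba; rewrite natrB ?leq_pexp2l ?(ltnW card_field_gt1) // !natrX.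
by rewrite mulrBr mulr1 -exprD subnKC.
Qed.

Lemma expB1_gt0 m : 0 < m -> (0 < q%:R ^+ m - 1 :> rat)%R.
Proof.
by move=> m0; rewrite subr_gt0 exprn_egt1 ?ltr1n ?card_field_gt1 // -lt0n.
Qed.

Lemma gauss_binom0 p a : gauss_binom p a 0 = 1%R.
Proof. by rewrite /gauss_binom big_ord0. Qed.

Lemma gauss_binomS p a b : (gauss_binom p a b.+1 =
  (p%:R ^+ a - 1) / (p%:R ^+ b.+1 - 1) * gauss_binom p a.-1 b)%R.
Proof.
rewrite /gauss_binom big_ord_recl /= !subn0; congr (_ * _)%R.
by apply: eq_bigr => i _; rewrite /bump /= add1n subSS subnS -subn1 subnAC subn1.
Qed.

Lemma card_interval W Z k : (W <= Z)%VS -> \dim W <= k ->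
  (#|interval W Z k|%:R = gauss_binom q (\dim Z - \dim W) (k - \dim W))%R.
Proof.
move=> WZ Wk; move Em: (k - \dim W) => m.
elim: m W WZ Wk Em => [|m IHm] W WZ Wk Em.
  have -> : k = \dim W by lia.
  by rewrite gauss_binom0 interval_id ?cards1.
have Wk' : \dim W < k by lia.
have Em' : k - (\dim W).+1 = m by lia.
have := congr1 (fun m => m%:R : rat)%R (interval_rec W Z k).
rewrite natr_sum.
rewrite (eq_bigr (fun=> gauss_binom q (\dim Z - \dim W).-1 m)); last first.
  move=> x /andP[xZ xW]; rewrite IHm ?dim_addv_line // -?subnS //.
  by rewrite subv_add WZ -memvE.
have cD := card_vectorsD WZ; rewrite cardsE in cD.
rewrite sumr_const cD natrM -(mulr_natl (gauss_binom _ _ _)).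
rewrite natr_expB // natr_expB ?dimvS //.
rewrite gauss_binomS Em mulrCA -mulrA => H.
have q0 : (q%:R ^+ \dim W != 0 :> rat)%R.
  by rewrite expf_neq0 // pnatr_eq0; have := card_field_gt1; lia.
have m0 : (q%:R ^+ m.+1 - 1 != 0 :> rat)%R by rewrite gt_eqF ?expB1_gt0.
apply: (mulIf m0); apply: (mulfI q0).
by rewrite H -!mulrA (mulrCA _^-1%R) mulVf // mulr1.
Qed.

Lemma card_interval_gt0 W Z k : (W <= Z)%VS -> \dim W <= k <= \dim Z ->
  0 < #|interval W Z k|.
Proof.
move=> WZ /andP[Wk kZ]; rewrite -(ltr_nat rat) card_interval //.
apply: prodr_gt0 => i _; have ik := ltn_ord i.
by apply: divr_gt0; apply: expB1_gt0; lia.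
Qed.

(** Each step of the recursion costs a factor of at most
    [q ^ \dim Z / (q ^ k - q ^ \dim W) <= q ^ (\dim Z - k + 1)]. *)
Lemma card_interval_le W Z k : (W <= Z)%VS -> \dim W <= k <= \dim Z ->
  #|interval W Z k| <= q ^ ((k - \dim W) * (\dim Z - k).+1).
Proof.
move=> WZ /andP[Wk kZ]; move Em: (k - \dim W) => m.
elim: m W WZ Wk Em => [|m IHm] W WZ Wk Em.
  have -> : k = \dim W by lia.
  by rewrite interval_id ?cards1 // mul0n.
have Wk' : \dim W < k by lia.
have Em' : k - (\dim W).+1 = m by lia.
set e := (\dim Z - k).+1 in IHm *.
have le1 : #|interval W Z k| * (q ^ k - q ^ \dim W) <= q ^ \dim Z * q ^ (m * e).
  rewrite interval_rec; apply: leq_trans (_ : \sum_(x : finvect_type V |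
     ((x : V) \in Z) && ((x : V) \notin W)) q ^ (m * e) <= _).
    apply: leq_sum => x /andP[xZ xW].
    by rewrite IHm ?dim_addv_line // subv_add WZ -memvE.
  have cD := card_vectorsD WZ; rewrite cardsE in cD.
  by rewrite sum_nat_const cD leq_mul2r leq_subr orbT.
have le2 : q ^ k.-1 <= q ^ k - q ^ \dim W.
  have /leq_trans-> // : q ^ k.-1 <= q ^ k - q ^ k.-1.
    have -> : q ^ k = q * q ^ k.-1 by rewrite -expnS prednK; lia.
    rewrite -[X in _ <= _ - X]mul1n -mulnBl leq_pmull //.
    by rewrite subn_gt0 card_field_gt1.
  apply: leq_sub2l; rewrite leq_pexp2l //; first by have := card_field_gt1; lia.
  lia.
have q0 : 0 < q ^ k.-1 by rewrite expn_gt0; have := card_field_gt1; lia.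
rewrite -(leq_pmul2r q0) (leq_trans (leq_mul (leqnn _) le2)) //.
rewrite (leq_trans le1) //.
by rewrite -!expnD (_ : \dim Z + m * e = m.+1 * e + k.-1) // /e mulSn; lia.
Qed.

Definition star W k := [set U in grassmannian V k | (W <= U)%VS].

Lemma starE W k : star W k = interval W fullv k.
Proof. by apply/setP=> U; rewrite !inE subvf andbT. Qed.

Lemma card_star W k : \dim W <= k ->
  (#|star W k|%:R = gauss_binom q (\dim {:V} - \dim W) (k - \dim W))%R.
Proof. by move=> Wk; rewrite starE card_interval ?subvf. Qed.

Lemma card_star_gt0 W k : \dim W <= k <= \dim {:V} -> 0 < #|star W k|.
Proof. by move=> Wk; rewrite starE card_interval_gt0 ?subvf. Qed.

Lemma card_star_dim W W' k : \dim W' = \dim W -> \dim W <= k ->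
  #|star W' k| = #|star W k|.
Proof.
by move=> eqW Wk; apply/eqP; rewrite -(eqr_nat rat) !card_star ?eqW.
Qed.

Lemma card_star_ratio T W k : \dim W = (\dim T).+1 -> \dim T < k <= \dim {:V} ->
  q ^ (\dim {:V} - k) * #|star W k| <= #|star T k|.
Proof.
move=> dW /andP[Tk kV]; set n := \dim {:V}; have q2 := card_field_gt1.
have H : #|star T k| * (q ^ k - q ^ \dim T) =
         (q ^ n - q ^ \dim T) * #|star W k|.
  rewrite starE interval_rec (eq_bigr (fun=> #|star W k|)); last first.
    move=> x /andP[_ xT].
    by rewrite -starE; apply: card_star_dim; rewrite ?dim_addv_line ?dW.
  have cD := card_vectorsD (subvf T); rewrite cardsE in cD.
  by rewrite sum_nat_const cD.
have D0 : 0 < q ^ k - q ^ \dim T by rewrite subn_gt0 ltn_exp2l.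
rewrite -(leq_pmul2r D0) H mulnAC leq_mul2r; apply/orP; right.
rewrite mulnBr -!expnD subnK // leq_sub2l // leq_pexp2l ?leq_addl //.
exact: ltnW.
Qed.

Lemma exists_vspace_dim d : d <= \dim {:V} -> exists T : {vspace V}, \dim T = d.
Proof.
move=> dV; have I0 : 0 < #|interval 0 {:V} d|.
  by apply: card_interval_gt0; rewrite ?sub0v ?dimv0.
case/card_gt0P: I0 => T; rewrite !inE => /andP[/eqP dT _]; by exists T.
Qed.
End Counting.

(** * Consequences of weak cross intersection *)

Section Cross.
Variables (K : finFieldType) (V : vectType K).
Implicit Types (U W Z T : {vspace V}) (FF GG : {set {vspace V}}).
Local Notation q := #|K|.

Lemma leq_card_bigcup (T I : finType) (P : pred I) (F : I -> {set T}) :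
  #|\bigcup_(i | P i) F i| <= \sum_(i | P i) #|F i|.
Proof.
elim/big_rec2: _ => [|i m A _ IH]; first by rewrite cards0.
by rewrite (leq_trans (leq_card_setU _ _)) // leq_add2l.
Qed.

Lemma inj_into_set (T : finType) (A : {set T}) m :
  m <= #|A| -> exists2 f : 'I_m -> T, injective f & forall i, f i \in A.
Proof.
move=> mA; exists (fun i => enum_val (widen_ord mA i)) => [i j /enum_val_inj|i].
  by move=> e; apply: val_inj; exact: (congr1 val e).
exact: enum_valP.
Qed.

Lemma inj_into_set_at (T : finType) (A : {set T}) m (x : T) :
  0 < m <= #|A| -> x \in A ->
  exists f : 'I_m -> T,
    [/\ injective f, forall i, f i \in A & exists i, f i = x].
Proof.
case: m => // m mA xA; have [f fI fA] := inj_into_set mA.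
have [/existsP[i /eqP fi]|/existsPn nx] := boolP [exists i, f i == x].
  by exists f; split => //; exists i.
exists (fun i => if i == ord0 then x else f i); split; last by exists ord0.
- move=> i j; case: eqP => [->|_]; case: eqP => [->|_] //.
  + by move=> xf; have := nx j; rewrite xf eqxx.
  + by move=> fx; have := nx i; rewrite fx eqxx.
  + exact: fI.
- by move=> i; case: eqP.
Qed.

Lemma weakly_cross_intersectingC l t FF GG :
  weakly_cross_intersecting l t FF GG -> weakly_cross_intersecting l t GG FF.
Proof.
move=> wFG G F Ginj Finj GG_G FF_F; have := wFG F G Finj Ginj FF_F GG_G.
rewrite exchange_big /=.
by under eq_bigr => i _ do under eq_bigr => j _ do rewrite capvC.
Qed.

(** l light members of FF would together contribute at most
    [l * (l * t - 1) = l ^ 2 * t - l]. *)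
Lemma few_light l t FF GG (H : 'I_l -> {vspace V}) : 0 < l ->
  weakly_cross_intersecting l t FF GG ->
  injective H -> (forall j, H j \in GG) ->
  #|[set F in FF | \sum_(j < l) \dim (F :&: H j) < l * t]| < l.
Proof.
move=> l0 wFG Hinj HG; rewrite ltnNge; apply/negP => /inj_into_set[F Finj FL].
have FP i : F i \in FF /\ \sum_(j < l) \dim (F i :&: H j) < l * t.
  by apply/andP; have := FL i; rewrite inE.
have := wFG F H Finj Hinj (fun i => (FP i).1) HG.
have : \sum_(i < l) (\sum_(j < l) \dim (F i :&: H j)).+1 <= \sum_(i < l) l * t.
  by apply: leq_sum => i _; case: (FP i).
rewrite sum_nat_const card_ord.
under eq_bigr => i _ do rewrite -addn1.
rewrite big_split /= sum_nat_const card_ord mulnA -mulnn muln1 => h1 h2.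
by have := leq_trans h2 h1; rewrite addn1 ltnn.
Qed.

(** The form in which [few_light] is used: the light members of S number at
    most [l - 1], so it is enough to cover the heavy ones. *)
Lemma card_cover_le l t FF GG (H : 'I_l -> {vspace V}) (S : {set {vspace V}})
    (B : 'I_l -> {set {vspace V}}) b : 0 < l ->
  weakly_cross_intersecting l t FF GG ->
  injective H -> (forall j, H j \in GG) -> S \subset FF ->
  (forall j, #|B j| <= b) ->
  (forall F, F \in S -> l * t <= \sum_(j < l) \dim (F :&: H j) ->
     exists j, F \in B j) ->
  #|S| <= l.-1 + l * b.
Proof.
move=> l0 wFG Hinj HG SF Bb cov; have light := few_light l0 wFG Hinj HG.
set L := [set F in FF | _] in light.
have : S \subset L :|: \bigcup_(j < l) B j.
  apply/subsetP=> F FS; rewrite !inE (subsetP SF) //= ltnNge.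
  case: leqP => //= /(cov F FS)[j Fj]; apply/bigcupP; by exists j.
move=> /subset_leq_card/leq_trans; apply.
apply: leq_trans (leq_card_setU _ _) _; apply: leq_add.
  by rewrite -ltnS prednK.
apply: leq_trans (leq_card_bigcup _ _) _.
rewrite -[l in l * b]card_ord -sum_nat_const; exact: leq_sum.
Qed.

(** A subspace through T that meets U outside T contains [T + <[x]>] for some
    of the at most [q ^ \dim U] vectors x of U outside T. *)
Lemma card_star_extra T U k A1 :
  (forall W, \dim W = (\dim T).+1 -> #|star W k| <= A1) ->
  #|[set F in star T k | ~~ (F :&: U <= T)%VS]| <= q ^ \dim U * A1.
Proof.
move=> hA1.
pose P (x : finvect_type V) := ((x : V) \in U) && ((x : V) \notin T).
have : [set F in star T k | ~~ (F :&: U <= T)%VS] \subset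
   \bigcup_(x | P x) star (T + <[x : V]>)%VS k.
  apply/subsetP=> F; rewrite !inE => /andP[/andP[dF TF] /subvPn[x]].
  rewrite memv_cap => /andP[xF xU] xT; apply/bigcupP.
  exists (x : finvect_type V); first by rewrite /P xU.
  by rewrite !inE dF subv_add TF -memvE.
move=> /subset_leq_card/leq_trans; apply.
apply: leq_trans (leq_card_bigcup _ _) _.
apply: leq_trans (_ : \sum_(x | P x) A1 <= _).
  by apply: leq_sum => x /andP[_ xT]; apply: hA1; rewrite dim_addv_line.
rewrite sum_nat_const leq_mul2r -card_vectors; apply/orP; right.
by apply: subset_leq_card; apply/subsetP=> x; rewrite !inE => /andP[].
Qed.

(** With G0 among the chosen members of GG, a subspace F through T that meets
    all of them inside T is light: each of them contributes at most t, and G0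
    at most [t - 1] because it does not contain T. *)
Lemma card_star_le l t k k' FF GG T G0 A1 : 0 < l <= #|GG| ->
  weakly_cross_intersecting l t FF GG ->
  FF \subset grassmannian V k -> GG \subset grassmannian V k' ->
  \dim T = t -> G0 \in GG -> ~~ (T <= G0)%VS ->
  (forall W, \dim W = t.+1 -> #|star W k| <= A1) ->
  #|FF :&: star T k| <= l.-1 + l * (q ^ k' * A1).
Proof.
move=> lG wFG FFk GGk dT G0G TG0 hA1; have l0 : 0 < l by case/andP: lG.
have [H [Hinj HG [j0 Hj0]]] := inj_into_set_at lG G0G.
pose B j := [set F in star T k | ~~ (F :&: H j <= T)%VS].
apply: (card_cover_le (B := B) l0 wFG Hinj HG); first exact: subsetIl.
  move=> j; have := subsetP GGk _ (HG j); rewrite inE => /eqP <-.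
  by apply: card_star_extra; rewrite dT.
move=> F /setIP[_ FT] heavy; apply/existsP; apply: contraLR heavy.
move=> /existsPn nB; rewrite -ltnNge.
have FHT j : (F :&: H j <= T)%VS by have := nB j; rewrite inE FT /= negbK.
have -> : l * t = \sum_(j < l) t by rewrite sum_nat_const card_ord.
rewrite (bigD1 j0) //= [ltnRHS](bigD1 j0) //= -addSn leq_add //; last first.
  by apply: leq_sum => j _; rewrite -dT dimvS.
rewrite ltn_neqAle -{2}dT dimvS // andbT -dT; apply: contra TG0 => /eqP d0.
have /eqP <- : (F :&: H j0 == T)%VS by rewrite eqEdim FHT d0 leqnn.
by rewrite -Hj0 capvSr.
Qed.

(** A heavy F meets one of l chosen members of GG in dimension at least t, hence
    lies in the star of one of their t-subspaces. *)
Lemma card_family_le l t k k' FF GG m : 0 < l <= #|GG| ->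
  weakly_cross_intersecting l t FF GG ->
  FF \subset grassmannian V k -> GG \subset grassmannian V k' -> t <= k' ->
  (forall T, \dim T = t -> #|FF :&: star T k| <= m) ->
  #|FF| <= l.-1 + l * (q ^ (t * (k' - t).+1) * m).
Proof.
move=> /andP[l0 lG] wFG FFk GGk tk' hm.
have [H Hinj HG] := inj_into_set lG.
pose B j := \bigcup_(T in interval 0 (H j) t) (FF :&: star T k).
apply: (card_cover_le (B := B) l0 wFG Hinj HG) => // [j|F FFF heavy].
  have := subsetP GGk _ (HG j); rewrite inE => /eqP dH.
  apply: leq_trans (leq_card_bigcup _ _) _.
  apply: leq_trans (_ : \sum_(T in interval 0 (H j) t) m <= _).
    by apply: leq_sum => T; rewrite !inE => /andP[/eqP dT _]; exact: hm.
  rewrite sum_nat_const leq_mul2r -dH; apply/orP; right.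
  have := @card_interval_le K V 0 (H j) t.
  by rewrite dimv0 subn0 dH; apply; rewrite ?sub0v.
have [j tj] : exists j, t <= \dim (F :&: H j).
  apply/existsP; apply: contraLR heavy => /existsPn hF; rewrite -ltnNge.
  have -> : l * t = \sum_(j < l) t by rewrite sum_nat_const card_ord.
  pose j0 := Ordinal l0.
  rewrite (bigD1 j0) //= [ltnRHS](bigD1 j0) //= -addSn leq_add //.
    by have := hF j0; rewrite -ltnNge.
  by apply: leq_sum => j _; have := hF j; rewrite -ltnNge; apply: ltnW.
exists j; have : 0 < #|interval 0 (F :&: H j) t|.
  by apply: card_interval_gt0; rewrite ?sub0v // dimv0.
case/card_gt0P=> T; rewrite !inE subv_cap => /andP[dT /and3P[_ TF TH]].
apply/bigcupP; exists T; first by rewrite !inE dT TH sub0v.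
by have := subsetP FFk _ FFF; rewrite !inE TF FFF => ->.
Qed.

End Cross.

(** * Numerical estimates *)

Lemma add_pred_mul_lt l y : 0 < l -> 0 < y -> l.-1 + l * y < 2 * (l * y).
Proof. by move=> l0 y0; have : l * 1 <= l * y; [rewrite leq_pmul2l|lia]. Qed.

Lemma cube_le_exp4 l : l ^ 3 <= 4 ^ l.
Proof.
(* the induction step needs [l >= 2]; the cases below hold by evaluation *)
elim: l => // [[|[|l]]] // IH.
by rewrite expnS (leq_trans _ (leq_mul (leqnn 4) IH)) // !expnS !expn0; nia.
Qed.

Lemma cube_le_exp q l : 1 < q -> 0 < l -> 8 * l ^ 3 <= q ^ (2 * l + 3).
Proof.
move=> q2 l0; apply: leq_trans (_ : 2 ^ (2 * l + 3) <= _); last first.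
  by rewrite leq_exp2r //; lia.
by rewrite expnD expnM mulnC leq_mul // cube_le_exp4.
Qed.

(** Applied to f, g the sizes of the two families, when every star contains at
    most [l - 1 + l * q ^ e * A1] members of the first.  The three terms
    [l - 1 + l * y < 2 * l * y] give the factor [8 * l ^ 3], which
    [q ^ (2 * l + 3)] absorbs. *)
Lemma no_heavy_star_absurd q l D E1 E2 e A A1 B f g :
  1 < q -> 0 < l -> 0 < A1 -> 0 < B ->
  3 + 2 * l + E1 + e + E2 <= D ->
  q ^ D * A1 <= A -> A * B <= f * g ->
  f <= l.-1 + l * (q ^ E1 * (l.-1 + l * (q ^ e * A1))) ->
  g <= l.-1 + l * (q ^ E2 * B) -> False.
Proof.
move=> q2 l0 A10 B0 hD hA hAB hf hg.
have q0 d : 0 < q ^ d by rewrite expn_gt0; lia.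
have y0 : 0 < q ^ e * A1 by rewrite muln_gt0 q0.
have hX : l.-1 + l * (q ^ e * A1) <= 2 * (l * (q ^ e * A1)).
  by apply: ltnW; apply: add_pred_mul_lt.
have X0 : 0 < l.-1 + l * (q ^ e * A1) by rewrite addn_gt0 muln_gt0 l0 y0 orbT.
have hf' : f < 2 * (l * (q ^ E1 * (2 * (l * (q ^ e * A1))))).
  apply: leq_ltn_trans hf _.
  apply: leq_trans (add_pred_mul_lt l0 _) _; first by rewrite muln_gt0 q0.
  by rewrite !leq_mul2l hX !orbT.
have hg' : g < 2 * (l * (q ^ E2 * B)).
  by apply: leq_ltn_trans hg _; rewrite add_pred_mul_lt // muln_gt0 q0.
have := leq_ltn_trans hAB (ltn_mul hf' hg'); rewrite ltnNge => /negP; apply.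
apply: leq_trans (_ : q ^ (2 * l + 3 + E1 + e + E2) * A1 * B <= _); last first.
  rewrite leq_mul2r (leq_trans _ hA) ?orbT // leq_mul2r.
  rewrite leq_pexp2l ?orbT //; lia.
have -> : 2 * (l * (q ^ E1 * (2 * (l * (q ^ e * A1))))) *
            (2 * (l * (q ^ E2 * B)))
   = (8 * l ^ 3) * (q ^ E1 * q ^ e * q ^ E2 * A1 * B).
  by rewrite !expnS expn0; nia.
have -> : q ^ (2 * l + 3 + E1 + e + E2) * A1 * B =
          q ^ (2 * l + 3) * (q ^ E1 * q ^ e * q ^ E2 * A1 * B).
  by rewrite (expnD _ _ E2) (expnD _ _ e) (expnD _ _ E1) !mulnA.
by rewrite leq_mul // cube_le_exp.
Qed.

(** Applied to f, g the sizes of the two families, when the second lies in the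
    star of T and some member of the first does not contain T. *)
Lemma partial_star_absurd q l D E1 e A B B1 f g :
  1 < q -> 0 < l -> 0 < A -> 0 < B1 ->
  2 + 2 * l + E1 + e <= D ->
  q ^ D * B1 <= B -> A * B <= f * g ->
  f <= l.-1 + l * (q ^ E1 * A) -> g <= l.-1 + l * (q ^ e * B1) -> False.
Proof.
move=> q2 l0 A0 B10 hD hB hAB hf hg.
have q0 d : 0 < q ^ d by rewrite expn_gt0; lia.
have hf' : f < 2 * (l * (q ^ E1 * A)).
  by apply: leq_ltn_trans hf _; rewrite add_pred_mul_lt // muln_gt0 q0.
have hg' : g < 2 * (l * (q ^ e * B1)).
  by apply: leq_ltn_trans hg _; rewrite add_pred_mul_lt // muln_gt0 q0.
have := leq_ltn_trans hAB (ltn_mul hf' hg'); rewrite ltnNge => /negP; apply.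
apply: leq_trans (_ : A * (q ^ (2 * l + 2 + E1 + e) * B1) <= _); last first.
  rewrite leq_mul2l (leq_trans _ hB) ?orbT // leq_mul2r.
  rewrite leq_pexp2l ?orbT //; lia.
have -> : 2 * (l * (q ^ E1 * A)) * (2 * (l * (q ^ e * B1)))
   = (2 * l) ^ 2 * (A * (q ^ E1 * q ^ e * B1)).
  by rewrite !expnS expn0; nia.
have -> : A * (q ^ (2 * l + 2 + E1 + e) * B1) =
          (q ^ l.+1) ^ 2 * (A * (q ^ E1 * q ^ e * B1)).
  rewrite -expnM (_ : l.+1 * 2 = 2 * l + 2); last by lia.
  by rewrite (expnD _ _ e) (expnD _ _ E1) -!mulnA mulnCA.
rewrite leq_mul // leq_exp2r // expnS leq_mul //.
exact: ltnW (ltn_expl _ _).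
Qed.

(** The bound on n supplies the exponents that the two preceding lemmas ask of
    [q ^ (n - k)] and [q ^ (n - k')]. *)
Lemma dimension_room k k' l t n : 0 < t -> k' <= k -> t + 1 <= k' ->
  (2 * k - t + 1) * (t + 1) + (k - t + 1) * k' + k + 2 * l - 1 <= n ->
  [/\ k < n,
      3 + 2 * l + t * (k' - t).+1 + k' + t * (k - t).+1 <= n - k &
      2 + 2 * l + t * (k' - t).+1 + k <= n - k'].
Proof.
move=> t0 k'k tk'.
(* In d and e the slack of the bound is a polynomial without subtractions. *)
have [e ek'] : exists e, k' = t + 1 + e by exists (k' - (t + 1)); lia.
have [d dk] : exists d, k = t + 1 + e + d by exists (k - k'); lia.
have -> : (k' - t).+1 = e.+2 by lia.
have -> : (k - t).+1 = (e + d).+2 by lia.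
have -> : 2 * k - t + 1 = 2 * e + 2 * d + t + 3 by lia.
have -> : k - t + 1 = e + d + 2 by lia.
have -> : (2 * e + 2 * d + t + 3) * (t + 1) + (e + d + 2) * k' =
  4 + t * e.+2 + k' + t * (e + d).+2 +
  (e * t + 2 * (d * t) + t * t + e * e + d * e + 4 * e + 3 * d + t).
  by rewrite ek'; lia.
set r := (X in _ + X + k); set u := t * e.+2; set v := t * (e + d).+2 => hn.
have uv : (e + d).+2 <= v by rewrite /v leq_pmull.
by split; lia.
Qed.

(** * Families with a large product lie in stars *)

Section LargeFamilies.
Variables (K : finFieldType) (V : vectType K).
Implicit Types (T W : {vspace V}) (FF GG : {set {vspace V}}).

Lemma large_families_are_in_stars k k' l t FF GG T0 :
  0 < t -> k' <= k -> t + 1 <= k' -> 0 < l ->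
  (2 * k - t + 1) * (t + 1) + (k - t + 1) * k' + k + 2 * l - 1 <= \dim {:V} ->
  FF \subset grassmannian V k -> GG \subset grassmannian V k' ->
  l <= #|FF| -> l <= #|GG| -> weakly_cross_intersecting l t FF GG ->
  \dim T0 = t -> #|star T0 k| * #|star T0 k'| <= #|FF| * #|GG| ->
  exists T, [/\ \dim T = t, FF \subset star T k & GG \subset star T k'].
Proof.
move=> t0 k'k tk' l0 hn FFk GGk lF lG wFG dT0 large.
have wGF := weakly_cross_intersectingC wFG.
have [kn room1 room2] := dimension_room t0 k'k tk' hn.
set n := \dim {:V} in hn kn room1 room2.
have [W0 dW0] : exists W0 : {vspace V}, \dim W0 = t.+1.
  by apply: exists_vspace_dim; lia.
set A := #|star T0 k| in large; set B := #|star T0 k'| in large.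
pose A1 := #|star W0 k|; pose B1 := #|star W0 k'|.
have A0 : 0 < A by apply: card_star_gt0; lia.
have B0 : 0 < B by apply: card_star_gt0; lia.
have A10 : 0 < A1 by apply: card_star_gt0; lia.
have B10 : 0 < B1 by apply: card_star_gt0; lia.
have hA T : \dim T = t -> #|star T k| <= A.
  by move=> dT; rewrite (@card_star_dim _ _ T0) ?dT; lia.
have hB T : \dim T = t -> #|star T k'| <= B.
  by move=> dT; rewrite (@card_star_dim _ _ T0) ?dT; lia.
have hA1 T : \dim T = t.+1 -> #|star T k| <= A1.
  by move=> dT; rewrite (@card_star_dim _ _ W0) ?dT; lia.
have hB1 T : \dim T = t.+1 -> #|star T k'| <= B1.
  by move=> dT; rewrite (@card_star_dim _ _ W0) ?dT; lia.
have rA : #|K| ^ (n - k) * A1 <= A by apply: card_star_ratio; lia.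
have rB : #|K| ^ (n - k') * B1 <= B by apply: card_star_ratio; lia.
have tk'' : t <= k' by lia.
have tk : t <= k by lia.
have lF' : 0 < l <= #|FF| by rewrite l0.
have lG' : 0 < l <= #|GG| by rewrite l0.
have bF : #|FF| <= l.-1 + l * (#|K| ^ (t * (k' - t).+1) * A).
  apply: (card_family_le lG' wFG FFk GGk tk'') => T dT.
  by apply: leq_trans (hA T dT); apply: subset_leq_card; apply: subsetIr.
have bG : #|GG| <= l.-1 + l * (#|K| ^ (t * (k - t).+1) * B).
  apply: (card_family_le lF' wGF GGk FFk tk) => T dT.
  by apply: leq_trans (hB T dT); apply: subset_leq_card; apply: subsetIr.
pose X := l.-1 + l * (#|K| ^ k' * A1).
have [T dT heavy] : exists2 T : {vspace V}, \dim T = t & X < #|FF :&: star T k|.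
  have [/existsP[T /andP[/eqP dT hT]]|/existsPn light] :=
    boolP [exists T : {vspace V}, (\dim T == t) && (X < #|FF :&: star T k|)].
    by exists T.
  case: (@no_heavy_star_absurd #|K| l _ _ _ _ _ _ _ _ _
    (card_field_gt1 K) l0 A10 B0 room1 rA large _ bG).
  apply: (card_family_le lG' wFG FFk GGk tk'') => T dT.
  by rewrite leqNgt; have := light T; rewrite dT eqxx.
have GT : GG \subset star T k'.
  apply/subsetP=> G GGG; have := subsetP GGk _ GGG; rewrite !inE => ->.
  apply: contraLR heavy => TG; rewrite -leqNgt.
  exact: card_star_le lG' wFG FFk GGk dT GGG TG hA1.
exists T; split=> //; apply/subsetP=> F FFF.
have := subsetP FFk _ FFF; rewrite !inE => -> /=; apply/negPn/negP => TF.
apply: (@partial_star_absurd #|K| l _ _ _ _ _ _ _ _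
  (card_field_gt1 K) l0 A0 B10 room2 rB large bF).
have := card_star_le lF' wGF GGk FFk dT FFF TF hB1.
by rewrite (setIidPl GT).
Qed.
End LargeFamilies.

Theorem theorem1p8 (k k' l t n : nat) (K : finFieldType) (V : vectType K)
    (FF GG : {set {vspace V}}) :
  0 < k -> 0 < k' -> 0 < l -> 0 < t ->
  k' <= k -> t + 1 <= k' -> 2 <= l ->
  (2 * k - t + 1) * (t + 1) + (k - t + 1) * k' + k + 2 * l - 1 <= n ->
  \dim {:V} = n ->
  FF \subset grassmannian V k ->
  GG \subset grassmannian V k' ->
  (* without l members in each family the next hypothesis is vacuous *)
  l <= #|FF| -> l <= #|GG| ->
  weakly_cross_intersecting l t FF GG ->
  ((#|FF| * #|GG|)%N%:R
     <= gauss_binom #|K| (n - t) (k - t) * gauss_binom #|K| (n - t) (k' - t))%R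
  /\ (((#|FF| * #|GG|)%N%:R
         = gauss_binom #|K| (n - t) (k - t)
           * gauss_binom #|K| (n - t) (k' - t))%R ->
      exists T : {vspace V},
        [/\ \dim T = t,
            FF = [set F in grassmannian V k | (T <= F)%VS] &
            GG = [set G in grassmannian V k' | (T <= G)%VS]]).
Proof.
move=> _ _ l0 t0 k'k tk' _ hn dV FFk GGk lF lG wFG.
have tn : t <= \dim {:V} by case: (dimension_room t0 k'k tk' hn); lia.
have tk'' : t <= k' by lia.
have tk := leq_trans tk'' k'k.
have [T0 dT0] := exists_vspace_dim tn.
have cA (T : {vspace V}) : \dim T = t ->
    (gauss_binom #|K| (n - t) (k - t) = #|star T k|%:R :> rat)%R.
  by move=> dT; rewrite card_star ?dT ?dV.
have cB (T : {vspace V}) : \dim T = t ->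
    (gauss_binom #|K| (n - t) (k' - t) = #|star T k'|%:R :> rat)%R.
  by move=> dT; rewrite card_star ?dT ?dV.
have [small|large] := ltnP (#|FF| * #|GG|) (#|star T0 k| * #|star T0 k'|).
  rewrite (cA T0) // (cB T0) // -natrM ler_nat; split; first exact: ltnW.
  by move/eqP; rewrite eqr_nat => /eqP eqN; move: small; rewrite eqN ltnn.
rewrite -dV in hn.
have [T [dT FT GT]] :=
  large_families_are_in_stars t0 k'k tk' l0 hn FFk GGk lF lG wFG dT0 large.
rewrite (cA T) // (cB T) // -natrM ler_nat.
have leF := subset_leq_card FT; have leG := subset_leq_card GT.
split; first exact: leq_mul.
move/eqP; rewrite eqr_nat => /eqP eqN; exists T; split=> //.
- apply/eqP; rewrite eqEcard FT /=; rewrite leqNgt; apply/negP => ltF.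
  have : #|FF| * #|GG| < #|star T k| * #|star T k'|.
    apply: leq_ltn_trans (leq_mul (leqnn _) leG) _.
    by rewrite ltn_pmul2r //; apply: leq_trans leG; lia.
  by rewrite eqN ltnn.
- apply/eqP; rewrite eqEcard GT /=; rewrite leqNgt; apply/negP => ltG.
  have : #|FF| * #|GG| < #|star T k| * #|star T k'|.
    apply: leq_ltn_trans (leq_mul leF (leqnn _)) _.
    by rewrite ltn_pmul2l //; apply: leq_trans leF; lia.
  by rewrite eqN ltnn.
Qed.
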